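(* Let $G(2,k)$ be the free nilpotent group on $2$ generators of nilpotency class $k$, with $G(2,\infty)=F_2$, the free group of rank $2$. If $k\ge 9$ (including the case $k=\infty$), then for every automorphism $\varphi:G(2,k)\to G(2,k)$ we have $R(\varphi)=\infty$; that is, $G(2,k)$ has the $R_\infty$ property.
   Context: $F_r$ is the free group of rank $r$ and $\Gamma_i(F_r)$ is the $i$-th term of its lower central series, with $\Gamma_1(F_r)=F_r$ and $\Gamma_{i+1}(F_r)=[\Gamma_i(F_r),F_r]$. For a positive integer $k$, $G(r,k)=F_r/\Gamma_{k+1}(F_r)$, and $G(r,\infty)=F_r$. For an endomorphism $\varphi:G\to G$ of a group, $G$ acts on itself by $\sigma\cdot\alpha=\sigma\alpha\varphi(\sigma)^{-1}$. The Reidemeister number $R(\varphi)$ is the number of orbits ($\infty$ if there are infinitely many). A group $G$ has the $R_\infty$ property if $R(\varphi)=\infty$ for every automorphism $\varphi$ of $G$. *)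

(* Defs.v *)
From HB Require Import structures.
From mathcomp Require Import all_boot.
From mathcomp Require Import boolp classical_sets cardinality.
From mathcomp Require Import constructive_ereal.
From mathcomp Require Import finmap.

Set Implicit Arguments.
Unset Strict Implicit.
Unset Printing Implicit Defensive.

Local Open Scope classical_set_scope.
Local Open Scope quotient_scope.
Local Open Scope group_scope.

Section Subgroups.
Variable G : groupType.
Implicit Types (A B H : set G) (x y g : G).

Definition subgroup H : Prop :=
  [/\ H 1, (forall x y, H x -> H y -> H (x * y)) & (forall x, H x -> H x^-1)].

Definition generated A : set G := smallest subgroup A.

Definition commutator_subgroup A B : set G :=
  generated [set [~ a, b] | a in A & b in B].

(* Numbered as in the literature, from 1; the index 0 is not meaningful and is
   also sent to the whole group. *)
Fixpoint lower_central (i : nat) : set G :=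
  match i with
  | 0 | 1 => setT
  | j.+1 => commutator_subgroup (lower_central j) setT
  end.

Record normal_subgroup := NormalSubgroup {
  normal_set : set G;
  normal_subgroupP : subgroup normal_set;
  normal_conj : forall x g, normal_set x -> normal_set (x ^ g)
}.

Lemma subgroup_generated A : subgroup (generated A).
Proof.
split=> [B [[]] // | x y Ax Ay B BA | x Ax B BA].
  by have [[_ BM _] _] := BA; apply: BM; [apply: Ax | apply: Ay].
by have [[_ _ BV] _] := BA; apply: BV; apply: Ax.
Qed.

Lemma generated_conj A g :
    (forall x, A x -> A (x ^ g)) ->
  forall x, generated A x -> generated A (x ^ g).
Proof.
move=> Ag x gAx.
suff /(_ x gAx): generated A `<=` [set y | generated A (y ^ g)] by [].
have [g1 gM gV] := subgroup_generated A.
apply: smallest_sub => [|y /Ag Ay /=]; last exact: sub_gen_smallest.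
split=> [|y z gy gz|y gy] /=; rewrite ?conj1g ?conjMg ?conjVg //.
- exact: gM.
- exact: gV.
Qed.

Lemma subgroup_lower_central i : subgroup (lower_central i).
Proof. by case: i => [|[|i]] //; apply: subgroup_generated. Qed.

Lemma lower_central_conj i x g : lower_central i x -> lower_central i (x ^ g).
Proof.
case: i => [|i] //; elim: i => [|i IHi] // in x g *.
apply: generated_conj => _ [a Ha [b _ <-]].
by exists (a ^ g); [exact: IHi | exists (b ^ g) => //; rewrite conjRg].
Qed.

Definition lower_central_normal (i : nat) : normal_subgroup :=
  NormalSubgroup (subgroup_lower_central i) (@lower_central_conj i).

End Subgroups.

Section QuotientGroup.
Variables (G : groupType) (N : normal_subgroup G).
Implicit Types x y z : G.

Local Notation inN := (normal_set N).

Let N1 : inN 1. Proof. by have [] := normal_subgroupP N. Qed.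
Let NM x y : inN x -> inN y -> inN (x * y).
Proof. by have [_ + _] := normal_subgroupP N; apply. Qed.
Let NV x : inN x -> inN x^-1.
Proof. by have [_ _ +] := normal_subgroupP N; apply. Qed.

Definition coset_rel : rel G := fun x y => `[< inN (x^-1 * y) >].

Lemma coset_rel_refl : reflexive coset_rel.
Proof. by move=> x; apply/asboolP; rewrite mulVg. Qed.

Lemma coset_rel_sym : symmetric coset_rel.
Proof.
by move=> x y; apply/asboolP/asboolP => /NV; rewrite invgM invgK.
Qed.

Lemma coset_rel_trans : transitive coset_rel.
Proof.
move=> y x z /asboolP Nxy /asboolP Nyz; apply/asboolP.
by have := NM Nxy Nyz; rewrite mulgA mulgK.
Qed.

Canonical coset_equiv :=
  EquivRel coset_rel coset_rel_refl coset_rel_sym coset_rel_trans.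

Definition quotient_group := {eq_quot coset_rel}.
HB.instance Definition _ := Choice.on quotient_group.
HB.instance Definition _ := EqQuotient.on quotient_group.

Definition coset (x : G) : quotient_group := \pi_quotient_group x.

Lemma cosetP x y : coset x = coset y <-> inN (x^-1 * y).
Proof.
split=> [/eqP|Nxy]; first by rewrite /coset eqmodE => /asboolP.
by apply/eqP; rewrite /coset eqmodE; apply/asboolP.
Qed.

Lemma coset_surj (u : quotient_group) : exists x, coset x = u.
Proof. by exists (repr u); rewrite /coset reprK. Qed.

Definition quotient_one : quotient_group := coset 1.
Definition quotient_mul (u v : quotient_group) : quotient_group :=
  coset (repr u * repr v).
Definition quotient_inv (u : quotient_group) : quotient_group :=
  coset (repr u)^-1.

Let N_repr x : inN (x^-1 * repr (coset x)).
Proof. by apply/cosetP; rewrite /coset reprK. Qed.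

Lemma coset_mul x y : quotient_mul (coset x) (coset y) = coset (x * y).
Proof.
apply/esym/cosetP; set x' := repr (coset x); set y' := repr (coset y).
have -> : (x * y)^-1 * (x' * y') = (x^-1 * x') ^ y * (y^-1 * y').
  by rewrite /conjg invgM !mulgA mulgK.
by apply: NM; [apply: normal_conj|]; apply: N_repr.
Qed.

Lemma coset_inv x : quotient_inv (coset x) = coset x^-1.
Proof.
apply/cosetP; rewrite invgK; set x' := repr (coset x).
have -> : x' * x^-1 = (x^-1 * x') ^ x^-1 by rewrite /conjg invgK !mulgA mulgV mul1g.
by apply: normal_conj; apply: N_repr.
Qed.

Lemma quotient_mulA : associative quotient_mul.
Proof.
move=> u v w; have [[x <-] [y <-] [z <-]] :=
  And3 (coset_surj u) (coset_surj v) (coset_surj w).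
by rewrite !coset_mul mulgA.
Qed.

Lemma quotient_mul1 : left_id quotient_one quotient_mul.
Proof. by move=> u; have [x <-] := coset_surj u; rewrite coset_mul mul1g. Qed.

Lemma quotient_mulr1 : right_id quotient_one quotient_mul.
Proof. by move=> u; have [x <-] := coset_surj u; rewrite coset_mul mulg1. Qed.

Lemma quotient_mulV : left_inverse quotient_one quotient_inv quotient_mul.
Proof.
by move=> u; have [x <-] := coset_surj u; rewrite coset_inv coset_mul mulVg.
Qed.

Lemma quotient_mulrV : right_inverse quotient_one quotient_inv quotient_mul.
Proof.
by move=> u; have [x <-] := coset_surj u; rewrite coset_inv coset_mul mulgV.
Qed.

HB.instance Definition _ := isGroup.Build quotient_group
  quotient_mulA quotient_mul1 quotient_mulr1 quotient_mulV quotient_mulrV.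

Lemma cosetM : {morph coset : x y / x * y}.
Proof. by move=> x y; rewrite -coset_mul. Qed.

HB.instance Definition _ := isGroupMorphism.Build G quotient_group coset
  (fun x y => etrans (cosetM x y^-1) (congr1 _ (esym (coset_inv y)))).

End QuotientGroup.

(* The letter (i, false) stands for the generator x_i and (i, true) for its
   inverse; the elements of the free group are the reduced words. *)
Section FreeGroup.
Variable r : nat.

Definition letter : Type := ('I_r * bool)%type.
HB.instance Definition _ := Countable.on letter.

Definition letter_inv (a : letter) : letter := (a.1, ~~ a.2).

Definition reduced (w : seq letter) : bool :=
  sorted (fun a b => b != letter_inv a) w.

Record free_group := FreeGroup {
  word :> seq letter;
  reduced_word : reduced word
}.

HB.instance Definition _ := [isSub for word].
HB.instance Definition _ := [Countable of free_group by <:].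

Definition push (a : letter) (w : seq letter) : seq letter :=
  if w is b :: w' then if b == letter_inv a then w' else a :: w else [:: a].

Lemma letter_invK : involutive letter_inv.
Proof. by case=> i b; rewrite /letter_inv /= negbK. Qed.

Lemma letter_inv_neq a : letter_inv a != a.
Proof. by case: a => i b; rewrite /letter_inv xpair_eqE /= eqxx; case: b. Qed.

Lemma reduced_behead a w : reduced (a :: w) -> reduced w.
Proof. exact: path_sorted. Qed.

Lemma reduced_push a w : reduced w -> reduced (push a w).
Proof.
case: w => //= b w Hbw; case: ifPn => [_|ba]; first exact: path_sorted Hbw.
by rewrite /= ba.
Qed.

Lemma pushK a w : reduced w -> push (letter_inv a) (push a w) = w.
Proof.
case: w => [|b w] /=; first by rewrite letter_invK eqxx.
have [-> Hw|_ _] := eqVneq b (letter_inv a); last first.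
  by rewrite /= letter_invK eqxx.
case: w Hw => [|c w] //= /andP[]; rewrite !letter_invK.
by move=> /negPf ->.
Qed.

Definition act (u w : seq letter) : seq letter := foldr push w u.

Lemma reduced_act u w : reduced w -> reduced (act u w).
Proof. by elim: u => //= a u IHu /IHu; apply: reduced_push. Qed.

Lemma act_push a u w : reduced w -> act (push a u) w = push a (act u w).
Proof.
move=> Hw; case: u => [|b u] //=; case: ifP => // /eqP ->.
by have /= := pushK (letter_inv a) (reduced_act u Hw); rewrite letter_invK.
Qed.

Lemma act_act u v w : reduced w -> act (act u v) w = act u (act v w).
Proof. by move=> Hw; elim: u => //= a u <-; rewrite act_push. Qed.

Lemma act_nil u : reduced u -> act u [::] = u.
Proof.
elim: u => //= a u IHu Hau; rewrite IHu; last exact: path_sorted Hau.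
by case: u Hau {IHu} => //= b u /andP[/negPf ->].
Qed.

Definition word_inv (w : seq letter) : seq letter := rev (map letter_inv w).

Lemma reduced_inv w : reduced w -> reduced (word_inv w).
Proof.
rewrite /word_inv /reduced rev_sorted sorted_map; apply: sub_sorted => a b /=.
by apply: contra => /eqP ->; rewrite !letter_invK.
Qed.

Lemma act_inv u w : reduced w -> act (word_inv u) (act u w) = w.
Proof.
elim: u w => //= a u IHu w Hw.
rewrite /word_inv /= rev_cons /act -cats1 foldr_cat /= -/(act u w).
by rewrite (pushK a (reduced_act u Hw)); apply: IHu.
Qed.

Definition free_one : free_group := @FreeGroup [::] isT.
Definition free_mul (u v : free_group) : free_group :=
  FreeGroup (reduced_act u (reduced_word v)).
Definition free_inv (u : free_group) : free_group :=
  FreeGroup (reduced_inv (reduced_word u)).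

Lemma free_mulA : associative free_mul.
Proof.
by move=> u v w; apply: val_inj; rewrite /= act_act //; apply: reduced_word.
Qed.

Lemma free_mul1 : left_id free_one free_mul.
Proof. by move=> u; apply: val_inj. Qed.

Lemma free_mulr1 : right_id free_one free_mul.
Proof.
by move=> u; apply: val_inj; rewrite /= act_nil //; apply: reduced_word.
Qed.

Lemma free_mulV : left_inverse free_one free_inv free_mul.
Proof.
move=> u; apply: val_inj => /=.
by rewrite -{2}(act_nil (reduced_word u)) act_inv.
Qed.

Lemma free_mulrV : right_inverse free_one free_inv free_mul.
Proof.
move=> u; have := free_mulV (free_inv u); congr (_ = _); congr free_mul.
apply: val_inj => /=; rewrite /word_inv map_rev revK -map_comp.
by rewrite (eq_map letter_invK) map_id.
Qed.

HB.instance Definition _ := isGroup.Build free_group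
  free_mulA free_mul1 free_mulr1 free_mulV free_mulrV.

Definition free_gen (i : 'I_r) : free_group := @FreeGroup [:: (i, false)] isT.

Section UniversalProperty.
Variables (H : groupType) (f : 'I_r -> H).

Let eval_letter (a : letter) : H := if a.2 then (f a.1)^-1 else f a.1.
Let eval_word (w : seq letter) : H := foldr (fun a h => eval_letter a * h) 1 w.

Definition free_lift (u : free_group) : H := eval_word u.

Let eval_letter_inv a : eval_letter (letter_inv a) = (eval_letter a)^-1.
Proof. by case: a => i [] //=; rewrite /eval_letter /= invgK. Qed.

Let eval_push a w : eval_word (push a w) = eval_letter a * eval_word w.
Proof.
case: w => [|b w] //=; case: ifP => // /eqP ->.
by rewrite eval_letter_inv mulVKg.
Qed.

Lemma free_liftM : {morph free_lift : u v / u * v}.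
Proof.
move=> [u Hu] [v Hv]; rewrite /free_lift /=.
elim: u {Hu} => [|a u IHu] /=; first by rewrite mul1g.
by rewrite eval_push IHu mulgA.
Qed.

Lemma free_lift_gen i : free_lift (free_gen i) = f i.
Proof. exact: mulg1. Qed.

Lemma free_lift_unique (g : free_group -> H) :
    {morph g : u v / u * v} -> (forall i, g (free_gen i) = f i) ->
  g =1 free_lift.
Proof.
move=> gM gf.
have g1 : g 1 = 1 by apply: (mulgI (g 1)); rewrite -gM !mulg1.
have gV u : g u^-1 = (g u)^-1.
  by apply: (mulgI (g u)); rewrite -gM !mulgV.
case=> u; elim: u => [|a u IHu] Hu.
  by rewrite /free_lift /= -g1; congr g; apply: val_inj.
have Ha : reduced [:: a] by [].
have Hu' := reduced_behead Hu.
have -> : FreeGroup Hu = FreeGroup Ha * FreeGroup Hu'.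
  apply: val_inj => /=; case: u Hu {IHu Hu'} => //= b u /andP[/negPf -> //].
rewrite gM free_liftM IHu; congr (_ * _); rewrite /free_lift /= mulg1.
case: a {Hu} Ha => i [] Ha; rewrite /eval_letter /= -gf -?gV;
  by congr g; apply: val_inj.
Qed.

End UniversalProperty.
End FreeGroup.

Definition free_nilpotent (r k : nat) : groupType :=
  quotient_group (lower_central_normal (free_group r) k.+1).

Section Reidemeister.
Variables (G : groupType) (phi : {multiplicative G -> G}).

Definition twisted_orbit (a : G) : set G :=
  [set s * a * (phi s)^-1 | s in [set: G]].

Definition twisted_orbits : set (set G) := range twisted_orbit.

Definition reidemeister_number : \bar nat :=
  if `[< finite_set twisted_orbits >]
  then EFin #|` fset_set twisted_orbits|%fset else +oo%E.

End Reidemeister.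

Definition R_infinity (G : groupType) : Prop :=
  forall phi : {multiplicative G -> G},
    bijective phi -> reidemeister_number phi = +oo%E.

(* Main.v *)
Require Import Defs.
From mathcomp Require Import all_boot.
From HB Require Import structures.
From mathcomp Require Import ssralg ssrint.
From mathcomp Require Import boolp classical_sets cardinality.
From mathcomp Require Import ring zify.

(* Only the quotient by the fifth term of the lower central series matters. An
   endomorphism [psi] of [F_2] covering the given automorphism acts on Z^2 by a
   matrix M with det M = 1 or -1. If 1 is an eigenvalue of M, the classes of
   the powers of a generator are already separated in Z^2. Otherwise an [s] with
   [s c^n psi(s)^-1 = c^m] has trivial image in Z^2 when [c] is a commutator.
   Such an [s] is a closed walk in the lattice Z^2, and summing a quadratic
   polynomial against its winding numbers gives a quantity that vanishes on the
   fifth term. If det M = 1, the total winding number is preserved by [psi] and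
   separates the powers of [x, y]. If det M = -1, the moments of degree 0 and 1
   of [s] vanish because -1 is not an eigenvalue of M (its trace is nonzero),
   and then the moment of the form Q(v) = det(v, M v) is preserved by [psi],
   because Q(M v) = - Q(v); it separates the powers of a suitable
   [[[x, y], g], g']. *)

Set Implicit Arguments.
Unset Strict Implicit.
Unset Printing Implicit Defensive.

Import GRing.Theory.

(** * The group of lattice walks *)

Local Notation plane := (int * int)%type.
Local Notation F2 := (free_group 2).
Local Notation endo := (UMagmaMorphism.type F2 F2).

Definition translate (w : plane) (h : plane -> int) : plane -> int :=
  fun v => h (v + w)%R.

Lemma translateD v w h : translate (v + w)%R h = translate v (translate w h).
Proof. by apply/funext => u; rewrite /translate addrA. Qed.

Lemma translate0 h : translate 0%R h = h.
Proof. by apply/funext => u; rewrite /translate addr0. Qed.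

(* A lattice walk is recorded by its endpoint and by the functional sending [h]
   to the signed sum of [h] over its horizontal edges (indexed by their left
   ends). The translation in [walk_mul] places the second walk at the endpoint
   of the first. *)
Definition walk : Type := (plane * ((plane -> int) -> int))%type.
HB.instance Definition _ := gen_eqMixin walk.
HB.instance Definition _ := gen_choiceMixin walk.

Definition walk_one : walk := (0%R, fun=> 0%R).
Definition walk_mul (s t : walk) : walk :=
  ((s.1 + t.1)%R, fun h => (s.2 h + t.2 (translate s.1 h))%R).
Definition walk_inv (s : walk) : walk :=
  ((- s.1)%R, fun h => (- s.2 (translate (- s.1) h))%R).

Lemma walk_mulA : associative walk_mul.
Proof.
move=> s t u; rewrite /walk_mul /= addrA; congr pair.
by apply/funext => h; rewrite [(s.1 + t.1)%R]addrC translateD addrA.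
Qed.

Lemma walk_mul1 : left_id walk_one walk_mul.
Proof.
case=> v t; rewrite /walk_mul /= add0r; congr pair.
by apply/funext => h; rewrite add0r translate0.
Qed.

Lemma walk_mulr1 : right_id walk_one walk_mul.
Proof.
case=> v t; rewrite /walk_mul /= addr0; congr pair.
by apply/funext => h; rewrite addr0.
Qed.

Lemma walk_mulV : left_inverse walk_one walk_inv walk_mul.
Proof.
move=> [v t]; rewrite /walk_mul /= addNr; congr pair.
by apply/funext => h; rewrite addNr.
Qed.

Lemma walk_mulrV : right_inverse walk_one walk_inv walk_mul.
Proof.
move=> [v t]; rewrite /walk_mul /= addrN; congr pair.
by apply/funext => h; rewrite -translateD addNr translate0 addrN.
Qed.

HB.instance Definition _ := isGroup.Build walk
  walk_mulA walk_mul1 walk_mulr1 walk_mulV walk_mulrV.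

Lemma free_group_closure r (P : free_group r -> Prop) :
    P 1%g -> (forall i, P (free_gen i)) ->
    (forall u v, P u -> P v -> P (u * v)%g) -> (forall u, P u -> P u^-1%g) ->
  forall w, P w.
Proof.
move=> P1 Pgen PM PV [w]; elim: w => [|a w IHw] Hw.
  by have -> : FreeGroup Hw = 1%g by apply: val_inj.
have Ha : reduced [:: a] by [].
have Hw' := reduced_behead Hw.
have -> : FreeGroup Hw = (FreeGroup Ha * FreeGroup Hw')%g.
  by apply: val_inj => /=; case: w Hw {IHw Hw'} => //= b w /andP[/negPf -> //].
apply: PM => //; case: a {Hw} Ha => i [] Ha.
  by have -> : FreeGroup Ha = (free_gen i)^-1%g;
    [apply: val_inj | apply/PV/Pgen].
by have -> : FreeGroup Ha = free_gen i by apply: val_inj.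
Qed.

Lemma hom1 (G H : groupType) (f : G -> H) :
  {morph f : u v / (u * v)%g} -> f 1%g = 1%g.
Proof. by move=> fM; apply: (mulgI (f 1%g)); rewrite -fM !mulg1. Qed.

(** * Endpoints and fluxes of words in F_2 *)

Definition gx : F2 := free_gen ord0.
Definition gy : F2 := free_gen ord_max.

Lemma ord2E (i : 'I_2) : (i = ord0) \/ (i = ord_max).
Proof. by case: i => [[|[|//]] Hi]; [left | right]; apply: val_inj. Qed.

Definition step (i : 'I_2) : walk :=
  if i == ord0 then ((1, 0)%R, fun h => h 0%R) else ((0, 1)%R, fun=> 0%R).

Definition endpoint (w : F2) : plane := (free_lift step w).1.
Definition flux (h : plane -> int) (w : F2) : int := (free_lift step w).2 h.

Lemma endpointM u v : endpoint (u * v)%g = (endpoint u + endpoint v)%R.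
Proof. by rewrite /endpoint free_liftM. Qed.

Lemma fluxM h u v :
  flux h (u * v)%g = (flux h u + flux (translate (endpoint u) h) v)%R.
Proof. by rewrite /flux free_liftM. Qed.

Lemma endpoint1 : endpoint 1%g = 0%R.
Proof. by []. Qed.

Lemma endpointV u : endpoint u^-1%g = (- endpoint u)%R.
Proof.
by apply/eqP; rewrite -addr_eq0 -endpointM mulVg.
Qed.

Lemma fluxV h u :
  flux h u^-1%g = (- flux (translate (- endpoint u) h) u)%R.
Proof.
by apply/eqP; rewrite -addr_eq0 -endpointV -fluxM mulVg.
Qed.

Lemma endpoint_x : endpoint gx = (1, 0)%R.
Proof. by rewrite /endpoint free_lift_gen. Qed.

Lemma endpoint_y : endpoint gy = (0, 1)%R.
Proof. by rewrite /endpoint free_lift_gen. Qed.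

Lemma flux_x h : flux h gx = h 0%R.
Proof. by rewrite /flux free_lift_gen. Qed.

Lemma flux_y h : flux h gy = 0%R.
Proof. by rewrite /flux free_lift_gen. Qed.

Lemma F2_closure (P : F2 -> Prop) :
    P 1%g -> P gx -> P gy ->
    (forall u v, P u -> P v -> P (u * v)%g) -> (forall u, P u -> P u^-1%g) ->
  forall w, P w.
Proof.
by move=> P1 Px Py PM PV; apply: free_group_closure => // i;
  case: (ord2E i) => ->.
Qed.

(** A [walk] may carry any functional; additivity in [h] holds for those generated by [step], hence
    the induction. *)
Lemma fluxD h h' w :
  flux (fun v => h v + h' v)%R w = (flux h w + flux h' w)%R.
Proof.
elim/F2_closure: w h h' => [h h'|h h'|h h'|u v IHu IHv h h'|u IHu h h'].
- by [].
- by rewrite !flux_x.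
- by rewrite !flux_y.
- by rewrite !fluxM IHu -addrACA -IHv.
- by rewrite !fluxV -opprD -IHu.
Qed.

Lemma flux_cst k w : flux (fun=> k) w = (k * (endpoint w).1)%R.
Proof.
elim/F2_closure: w => [||| u v IHu IHv|u IHu].
- by rewrite mulr0.
- by rewrite flux_x endpoint_x mulr1.
- by rewrite flux_y endpoint_y mulr0.
- by rewrite fluxM endpointM mulrDr IHu -IHv.
- by rewrite fluxV endpointV mulrN -IHu.
Qed.

Lemma endpointR u v : endpoint [~ u, v]%g = 0%R.
Proof. by rewrite /commg /conjg !endpointM !endpointV addrA -opprD addNr. Qed.

Lemma endpointJ u v : endpoint (u ^ v)%g = endpoint u.
Proof. by rewrite /conjg !endpointM !endpointV addrCA addNr addr0. Qed.

Lemma endpointX u n : endpoint (u ^+ n)%g = (endpoint u *+ n)%R.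
Proof. by elim: n => // n IHn; rewrite expgS endpointM IHn mulrS. Qed.

Lemma fluxM0 h u v : endpoint u = 0%R ->
  flux h (u * v)%g = (flux h u + flux h v)%R.
Proof. by move=> u0; rewrite fluxM u0 translate0. Qed.

Lemma fluxV0 h u : endpoint u = 0%R -> flux h u^-1%g = (- flux h u)%R.
Proof. by move=> u0; rewrite fluxV u0 oppr0 translate0. Qed.

Lemma fluxX0 h u n : endpoint u = 0%R -> flux h (u ^+ n)%g = (flux h u *+ n)%R.
Proof. by move=> u0; elim: n => // n IHn; rewrite expgS fluxM0 // IHn mulrS. Qed.

(** The walk follows [v^-1], goes around the closed [u] and returns by the same path, so the two
    legs cancel. *)
Lemma fluxJ h u v : endpoint u = 0%R ->
  flux h (u ^ v)%g = flux (translate (- endpoint v)%R h) u.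
Proof.
move=> u0; rewrite /conjg fluxM fluxV endpointV fluxM0 // addrCA addNr addr0 //.
Qed.

(* By discrete Green's formula, the flux of [h] through a closed walk is the sum
   of [density h] against its winding numbers; see [flux_wsum]. *)
Definition density (h : plane -> int) : plane -> int :=
  fun v => (h (v + (-1, -1)) - h (v + (-1, 0)))%R.

(** The walk x^-1 y^-1 x y bounds the unit square with top right corner at the origin, whence the
    offsets in [density]. *)
Lemma flux_xy h : flux h [~ gx, gy]%g = density h 0%R.
Proof.
rewrite /commg /conjg !fluxM !fluxV !endpointV flux_x !flux_y endpoint_x endpoint_y.
rewrite oppr0 add0r flux_x /translate addr0 /density; rewrite addrC; congr (h _ - h _)%R.
Qed.

(** The integrand has density 1, so this is the enclosed area. It is additive on words up to the
    cocycle in [areaM], which the commutator antisymmetrises. *)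
Lemma flux_area u v :
  flux (fun p => - p.2)%R [~ u, v]%g =
  ((endpoint u).1 * (endpoint v).2 - (endpoint u).2 * (endpoint v).1)%R.
Proof.
have areaM u' v' : flux (fun p => - p.2)%R (u' * v')%g =
    (flux (fun p => - p.2)%R u' + flux (fun p => - p.2)%R v'
     - (endpoint u').2 * (endpoint v').1)%R.
  rewrite fluxM -addrA; congr +%R; rewrite -mulNr -flux_cst -fluxD.
  by congr flux; apply/funext => p; rewrite /translate /= opprD.
have := congr1 (flux (fun p => - p.2)%R) (commgC u v).
rewrite !areaM endpointR mulr0; lia.
Qed.

(** * Integer powers in a group *)

Section IntegerPowers.
Local Open Scope group_scope.
Variable G : groupType.
Implicit Types x y : G.

Definition expgz x (z : int) : G :=
  match z with Posz n => x ^+ n | Negz n => x ^- n.+1 end.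

Lemma expgzB x (m n : nat) : expgz x (m%:Z - n%:Z)%R = x ^+ m * x ^- n.
Proof.
have [le_nm|lt_mn] := leqP n m; first by rewrite subzn //= expgnFr.
rewrite -opprB subzn 1?ltnW // -[(n - m)%N]prednK ?subn_gt0 //.
rewrite -NegzE /= prednK ?subn_gt0 // expgnFr 1?ltnW //.
by rewrite invgM invgK.
Qed.

Lemma int_diff (z : int) : exists m n : nat, z = (m%:Z - n%:Z)%R.
Proof.
by case: z => n; [exists n, 0; rewrite subr0 | exists 0, n.+1; rewrite sub0r NegzE].
Qed.

Lemma expgzD x a b : expgz x (a + b)%R = expgz x a * expgz x b.
Proof.
have [[m [n ->]] [m' [n' ->]]] := (int_diff a, int_diff b).
rewrite addrACA -opprD [(n%:Z + _)%R]addrC -!PoszD !expgzB !expgnDr invgM !mulgA.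
congr (_ * _); rewrite -!mulgA; congr (_ * _).
exact/commuteV/commuteX2.
Qed.

Lemma commute_expgz x y a b : commute x y -> commute (expgz x a) (expgz y b).
Proof.
move=> xy; have [[m [n ->]] [m' [n' ->]]] := (int_diff a, int_diff b).
rewrite !expgzB; have := commuteX2 _ _ xy => cX.
apply: commuteM; last apply: commuteV; apply: commute_sym; apply: commuteM;
  try apply: commuteV; apply/commute_sym/cX.
Qed.

End IntegerPowers.

(** * The kernel of [endpoint] as a normal closure *)

Section KernelOfEndpoint.
Local Open Scope group_scope.
Local Open Scope classical_set_scope.

Definition commutator_closure : set F2 :=
  generated [set [~ gx, gy] ^ g | g in setT].

Lemma commutator_closure_conj x g :
  commutator_closure x -> commutator_closure (x ^ g).
Proof.
apply: generated_conj => _ [u _ <-]; exists (u * g) => //.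
by rewrite conjgM.
Qed.

Let N : normal_subgroup F2 :=
  NormalSubgroup (subgroup_generated _) commutator_closure_conj.

(** Modulo the normal closure the generators commute, so [rho] after [endpoint] is a morphism. It
    agrees with the coset map on generators, so the coset of [w] depends only on [endpoint w]. *)
Lemma commutator_closure_endpoint w :
  endpoint w = 0%R -> commutator_closure w.
Proof.
pose X := coset N gx; pose Y := coset N gy.
have XY : commute X Y.
  rewrite /commute /X /Y -!gmulfM; apply/esym/cosetP.
  apply: sub_gen_smallest; exists 1 => //.
  by rewrite conjg1 /commg /conjg invgM !mulgA.
pose rho (v : plane) := expgz X v.1 * expgz Y v.2.
have rhoM : {morph rho \o endpoint : u v / u * v}.
  move=> u v; rewrite /rho /= endpointM !expgzD !mulgA; congr (_ * _).
  by rewrite -!mulgA; congr (_ * _); apply: commute_expgz.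
have gen i : rho (endpoint (free_gen i)) = coset N (free_gen i).
  case: (ord2E i) => ->; first by rewrite endpoint_x /rho /= mulg1.
  by rewrite endpoint_y /rho /= mul1g.
move=> w0; suff /cosetP : coset N 1 = coset N w by rewrite invg1 mul1g.
have cosetE := @free_lift_unique _ _ (fun i => coset N (free_gen i)).
rewrite (cosetE _ (@cosetM _ N)) // [RHS](cosetE _ (@cosetM _ N)) //.
by rewrite -!(cosetE _ rhoM gen) /= w0 endpoint1.
Qed.

Lemma ker_endpoint_ind (P : F2 -> Prop) :
    P 1 -> (forall g, P ([~ gx, gy] ^ g)) ->
    (forall u v, endpoint u = 0%R -> endpoint v = 0%R ->
       P u -> P v -> P (u * v)) ->
    (forall u, endpoint u = 0%R -> P u -> P u^-1) ->
  forall w, endpoint w = 0%R -> P w.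
Proof.
move=> P1 Pg PM PV w /commutator_closure_endpoint.
suff /[apply] : commutator_closure `<=` [set u | endpoint u = 0%R /\ P u].
  by case.
apply: smallest_sub => [|_ [g _ <-]]; last by rewrite /= endpointJ endpointR.
split=> [|u v [u0 Pu] [v0 Pv]|u [u0 Pu]] /=; first by [].
  by rewrite endpointM u0 v0 addr0; split=> //; apply: PM.
by rewrite endpointV u0 oppr0; split=> //; apply: PV.
Qed.

End KernelOfEndpoint.

(** * Winding numbers, their moments and the action of [psi] *)

Section Flux.
Local Open Scope ring_scope.

Lemma fluxB h h' w : flux (fun v => h' v - h v) w = flux h' w - flux h w.
Proof.
apply/eqP; rewrite eq_sym subr_eq -fluxD; apply/eqP; congr flux.
by apply/funext => v; rewrite subrK.
Qed.

(** For a morphism [psi], this is the action of the matrix M on Z^2; see [endpoint_hom]. *)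
Definition lin (psi : F2 -> F2) (v : plane) : plane :=
  ((endpoint (psi gx)).1 * v.1 + (endpoint (psi gy)).1 * v.2,
   (endpoint (psi gx)).2 * v.1 + (endpoint (psi gy)).2 * v.2).

Lemma linD psi u v : lin psi (u + v) = lin psi u + lin psi v.
Proof. by congr pair => /=; ring. Qed.

Lemma linN psi v : lin psi (- v) = - lin psi v.
Proof. by congr pair => /=; ring. Qed.

Lemma endpoint_hom (psi : endo) w :
  endpoint (psi w) = lin psi (endpoint w).
Proof.
elim/F2_closure: w => [||| u v IHu IHv|u IHu].
- by rewrite gmulf1 endpoint1 /lin !mulr0 !addr0.
- by rewrite endpoint_x /lin !mulr1 !mulr0 !addr0; case: endpoint.
- by rewrite endpoint_y /lin !mulr1 !mulr0 !add0r; case: endpoint.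
- by rewrite gmulfM !endpointM linD IHu IHv.
- by rewrite gmulfV !endpointV linN IHu.
Qed.

(* Sum of [f] against the winding numbers encoded by the list [L]. *)
Definition wsum (L : seq (int * plane)) (f : plane -> int) : int :=
  \sum_(i <- L) i.1 * f i.2.

Lemma wsum_nil f : wsum [::] f = 0.
Proof. exact: big_nil. Qed.

Lemma wsum_cons i L f : wsum (i :: L) f = i.1 * f i.2 + wsum L f.
Proof. exact: big_cons. Qed.

Lemma wsum_cat L L' f : wsum (L ++ L') f = wsum L f + wsum L' f.
Proof. exact: big_cat. Qed.

Lemma wsum_opp L f : wsum [seq (- i.1, i.2) | i <- L] f = - wsum L f.
Proof. by rewrite /wsum big_map -sumrN; apply: eq_bigr => i _; rewrite mulNr. Qed.

Lemma eq_wsum L f f' : f =1 f' -> wsum L f = wsum L f'.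
Proof. by move=> ff'; apply: eq_bigr => i _; rewrite ff'. Qed.

(* The kernel of [endpoint] is the normal closure of [gx, gy], and [L] records
   the conjugates and signs that express [s]; hence it serves every [psi]. *)
Lemma winding s : endpoint s = 0 ->
  exists L, forall (psi : endo) h,
    flux h (psi s) =
    wsum L (fun v => flux (translate (lin psi v) h) [~ psi gx, psi gy]%g).
Proof.
move: s; apply: ker_endpoint_ind => [|g|u v u0 v0 [L HL] [L' HL']|u u0 [L HL]].
- by exists [::] => psi h; rewrite wsum_nil gmulf1.
- exists [:: (1, - endpoint g)] => psi h.
  rewrite wsum_cons wsum_nil addr0 mul1r gmulfJ gmulfR fluxJ ?endpointR //.
  by rewrite endpoint_hom linN.
- exists (L ++ L') => psi h; rewrite wsum_cat gmulfM fluxM0 ?HL ?HL' //.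
  by rewrite endpoint_hom u0 /lin !mulr0 !addr0.
- exists [seq (- i.1, i.2) | i <- L] => psi h.
  rewrite wsum_opp gmulfV fluxV0 ?HL //.
  by rewrite endpoint_hom u0 /lin !mulr0 !addr0.
Qed.

(** The identity in [winding] gives Green's formula. Sharing [L] lets the fluxes through [s] and
    [psi s] be compared. *)
Lemma flux_wsum s : endpoint s = 0 ->
  exists L, (forall h, flux h s = wsum L (density h)) /\
  forall (psi : endo) h,
    flux h (psi s) =
    wsum L (fun v => flux (translate (lin psi v) h) [~ psi gx, psi gy]%g).
Proof.
move=> /winding[L HL]; exists L; split=> // h.
have linid v : lin id v = v.
  rewrite /lin endpoint_x endpoint_y; case: v => a b.
  by congr pair => /=; ring.
rewrite (HL idfun); apply: eq_wsum => v; rewrite linid flux_xy.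
by rewrite /density /translate !add0r ![(v + _)%R]addrC.
Qed.

Definition quad (c0 c1 c2 c3 c4 c5 : int) (v : plane) : int :=
  c0 + c1 * v.1 + c2 * v.2 + c3 * v.1 ^+ 2 + c4 * v.1 * v.2 + c5 * v.2 ^+ 2.

(* A primitive of [quad] for [density], up to the factor 6 that keeps the
   coefficients integral. *)
Definition prim (c0 c1 c2 c3 c4 c5 : int) (v : plane) : int :=
  let a := v.1 + 1 in let b := v.2 in
  - (6 * c0 * b + 6 * c1 * a * b + 3 * c2 * b * (b + 1) + 6 * c3 * a ^+ 2 * b
     + 3 * c4 * a * b * (b + 1) + c5 * b * (b + 1) * (2 * b + 1)).

Lemma density_prim c0 c1 c2 c3 c4 c5 v :
  density (prim c0 c1 c2 c3 c4 c5) v = 6 * quad c0 c1 c2 c3 c4 c5 v.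
Proof. by case: v => a b; rewrite /density /prim /quad /=; ring. Qed.

Lemma wsum_quad L c0 c1 c2 c3 c4 c5 :
  wsum L (quad c0 c1 c2 c3 c4 c5) =
  c0 * wsum L (fun=> 1) + c1 * wsum L (fun v => v.1) + c2 * wsum L (fun v => v.2)
  + c3 * wsum L (fun v => v.1 ^+ 2) + c4 * wsum L (fun v => v.1 * v.2)
  + c5 * wsum L (fun v => v.2 ^+ 2).
Proof.
elim: L => [|i L IHL]; first by rewrite !wsum_nil; ring.
by rewrite !wsum_cons IHL /quad; ring.
Qed.

Lemma wsumZ L k f : wsum L (fun v => k * f v) = k * wsum L f.
Proof. by rewrite /wsum mulr_sumr; apply: eq_bigr => i _; rewrite mulrCA. Qed.

Lemma wsum_density_prim L c0 c1 c2 c3 c4 c5 :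
  wsum L (density (prim c0 c1 c2 c3 c4 c5)) = 6 * wsum L (quad c0 c1 c2 c3 c4 c5).
Proof. by rewrite -wsumZ; apply: eq_wsum => v; rewrite density_prim. Qed.

Lemma density_translate w h v : density (translate w h) v = density h (v + w).
Proof. by rewrite /density /translate ![v + w + _]addrAC. Qed.

Lemma quad_translate c0 c1 c2 c3 c4 c5 (u w : plane) :
  quad c0 c1 c2 c3 c4 c5 (u + w) =
  quad (quad c0 c1 c2 c3 c4 c5 w) (c1 + 2 * c3 * w.1 + c4 * w.2)
       (c2 + c4 * w.1 + 2 * c5 * w.2) c3 c4 c5 u.
Proof. by rewrite /quad /=; ring. Qed.

(* [l0, ..., l5] are the moments of the winding numbers of [s], and [k0, ..., k5]
   those of the winding numbers of [psi gx, psi gy]. *)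
Lemma flux_prim_hom (psi : endo) s :
    endpoint s = 0 ->
  let p := (endpoint (psi gx)).1 in let q := (endpoint (psi gy)).1 in
  let r := (endpoint (psi gx)).2 in let t := (endpoint (psi gy)).2 in
  exists l0 l1 l2 l3 l4 l5 k1 k2 k3 k4 k5 : int, forall c0 c1 c2 c3 c4 c5,
    let k0 := p * t - q * r in
    let e1 := k0 * c1 + 2 * c3 * k1 + c4 * k2 in
    let e2 := k0 * c2 + c4 * k1 + 2 * c5 * k2 in
    flux (prim c0 c1 c2 c3 c4 c5) s =
      6 * (c0 * l0 + c1 * l1 + c2 * l2 + c3 * l3 + c4 * l4 + c5 * l5) /\
    flux (prim c0 c1 c2 c3 c4 c5) (psi s) =
      6 * ((k0 * c0 + k1 * c1 + k2 * c2 + c3 * k3 + c4 * k4 + c5 * k5) * l0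
           + (e1 * p + e2 * r) * l1 + (e1 * q + e2 * t) * l2
           + k0 * (c3 * p ^+ 2 + c4 * p * r + c5 * r ^+ 2) * l3
           + k0 * (2 * c3 * p * q + c4 * (p * t + q * r) + 2 * c5 * r * t) * l4
           + k0 * (c3 * q ^+ 2 + c4 * q * t + c5 * t ^+ 2) * l5).
Proof.
move=> s0 p q r t; have [L [HL HLpsi]] := flux_wsum s0.
have [K [HK _]] := flux_wsum (endpointR (psi gx) (psi gy)).
have K0 : wsum K (fun=> 1) = p * t - q * r.
  rewrite [q * r]mulrC -[RHS]flux_area HK; apply: eq_wsum => v.
  by rewrite /density /=; ring.
exists (wsum L (fun=> 1)), (wsum L (fun v => v.1)), (wsum L (fun v => v.2)),
  (wsum L (fun v => v.1 ^+ 2)), (wsum L (fun v => v.1 * v.2)),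
  (wsum L (fun v => v.2 ^+ 2)), (wsum K (fun v => v.1)),
  (wsum K (fun v => v.2)), (wsum K (fun v => v.1 ^+ 2)),
  (wsum K (fun v => v.1 * v.2)), (wsum K (fun v => v.2 ^+ 2)).
move=> c0 c1 c2 c3 c4 c5 k0 e1 e2.
have flux_shift w : flux (translate w (prim c0 c1 c2 c3 c4 c5)) [~ psi gx, psi gy]%g
    = 6 * wsum K (quad (quad c0 c1 c2 c3 c4 c5 w) (c1 + 2 * c3 * w.1 + c4 * w.2)
       (c2 + c4 * w.1 + 2 * c5 * w.2) c3 c4 c5).
  rewrite HK -wsumZ; apply: eq_wsum => u.
  by rewrite density_translate density_prim quad_translate.
rewrite HL wsum_density_prim wsum_quad HLpsi; split; first by ring.
(* The sum over [K] is a quadratic polynomial in w = [lin psi v], where [e1] and [e2] are the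
   coefficients of w.1 and w.2. *)
under eq_wsum do rewrite flux_shift wsum_quad K0.
rewrite wsumZ /e1 /e2 /k0; congr (6 * _); rewrite /lin -/p -/q -/r -/t.
set k1 := wsum K _; set k2 := wsum K _; set k3 := wsum K _; set k4 := wsum K _.
set k5 := wsum K _; move: k1 k2 k3 k4 k5 => k1 k2 k3 k4 k5.
elim: {HL HLpsi} L => [|i L IHL]; first by rewrite !wsum_nil; ring.
by rewrite !wsum_cons IHL /quad /=; ring.
Qed.

(** * Fluxes on the lower central series *)

(* The [density] of [h] is a polynomial of degree less than [d]. *)
Fixpoint density_deg_lt (d : nat) (h : plane -> int) : Prop :=
  match d with
  | 0 => forall v, density h v = 0
  | d'.+1 => forall w, density_deg_lt d' (fun v => translate w h v - h v)
  end.

Lemma prim_deg c0 c1 c2 c3 c4 c5 : density_deg_lt 3 (prim c0 c1 c2 c3 c4 c5).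
Proof. by move=> u v w z; rewrite /density /translate /prim /=; ring. Qed.

Lemma linear_prim_deg c0 c1 c2 : density_deg_lt 2 (prim c0 c1 c2 0 0 0).
Proof. by move=> u v z; rewrite /density /translate /prim /=; ring. Qed.

(** Since [a, b] = a^-1 a^b and conjugation translates, a commutator with [b] acts on [h] as a
    difference operator and so lowers the bound in [density_deg_lt]. *)
Lemma flux_commg h a b : endpoint a = 0 ->
  flux h [~ a, b]%g = flux (fun v => translate (- endpoint b) h v - h v) a.
Proof.
move=> a0; rewrite commgEl fluxM0 ?endpointV ?a0 ?oppr0 //.
by rewrite fluxV0 // fluxJ // fluxB addrC.
Qed.

Definition flux_killed (d : nat) : set F2 :=
  [set s | endpoint s = 0 /\ forall h, density_deg_lt d h -> flux h s = 0].

Lemma subgroup_flux_killed d : Defs.subgroup (flux_killed d).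
Proof.
split=> [|u v [u0 Hu] [v0 Hv]|u [u0 Hu]]; first by [].
  by split=> [|h Hh]; rewrite ?endpointM ?fluxM0 ?u0 ?v0 ?Hu ?Hv ?addr0.
by split=> [|h Hh]; rewrite ?endpointV ?fluxV0 ?u0 ?Hu ?oppr0.
Qed.

(** The first commutator closes the walk and each further one takes a difference, whence the shift
    by 2. For d = 3, quadratic densities vanish on the fifth term. *)
Lemma lower_central_flux_killed d :
  (lower_central d.+2 `<=` flux_killed d)%classic.
Proof.
elim: d => [|d IHd]; apply: smallest_sub; try exact: subgroup_flux_killed.
  move=> _ [a _ [b _ <-]]; split=> [|h Hh]; first exact: endpointR.
  have [L [-> _]] := flux_wsum (endpointR a b).
  by apply: big1 => i _; rewrite Hh mulr0.
move=> _ [a /IHd[a0 Ha] [b _ <-]]; split=> [|h Hh]; first exact: endpointR.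
by rewrite flux_commg // Ha.
Qed.

Lemma lower_central_commg i a b :
  lower_central i.+1 a -> lower_central i.+2 ([~ a, b] : F2)%g.
Proof. by move=> Ha; apply: sub_gen_smallest; exists a => //; exists b. Qed.

Lemma flux_lower_central d s h :
  lower_central d.+2 s -> density_deg_lt d h -> flux h s = 0.
Proof. by case/lower_central_flux_killed=> _; apply. Qed.

Lemma endpoint_lower_central d s : lower_central d.+2 s -> endpoint s = 0.
Proof. by case/lower_central_flux_killed. Qed.

(** Two successive differences turn the quadratic form into its polar bilinear form at the two
    endpoints. *)
Lemma flux_double_commg c3 c4 c5 g g' :
  flux (prim 0 0 0 c3 c4 c5) [~ [~ [~ gx, gy], g], g']%g =
  6 * (2 * c3 * (endpoint g).1 * (endpoint g').1
       + c4 * ((endpoint g).1 * (endpoint g').2 + (endpoint g).2 * (endpoint g').1)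
       + 2 * c5 * (endpoint g).2 * (endpoint g').2).
Proof.
rewrite flux_commg ?endpointR // flux_commg ?endpointR // flux_xy
  /density /translate /prim /=; ring.
Qed.

(** M - 1 is singular, so the rows of its adjugate are left null vectors. Up to sign they are the
    witnesses; (1, 0) serves when p = 1 and q = r = 0. *)
Lemma left_fixed_vector (p q r t : int) :
    (p - 1) * (t - 1) - q * r = 0 ->
  exists l1 l2, [/\ l1 * p + l2 * r = l1, l1 * q + l2 * t = l2
                  & (l1 != 0) || (l2 != 0)].
Proof.
move=> detM1.
have [r0|r0] := eqVneq r 0; last first.
  by exists r, (1 - p); rewrite r0; split=> //; lia.
have [p1|p1] := eqVneq p 1; last first.
  by exists r, (1 - p); rewrite subr_eq0 [1 == p]eq_sym p1 orbT; split=> //; lia.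
have [q0|q0] := eqVneq q 0.
  by exists 1, 0; rewrite p1 r0 q0; split=> //; lia.
exists (1 - t), q; rewrite q0 orbT r0 p1; split=> //; lia.
Qed.

(** The hypothesis makes [c ^+ n] and [c ^+ m] twisted conjugate modulo the fifth term. *)
Definition separates (psi : F2 -> F2) (c : F2) : Prop := forall s (n m : nat),
  lower_central 5 (s * c ^+ n * (psi s)^-1 * c ^- m)%g -> n = m.

Lemma plane_mulrn (v : plane) (n : nat) : v *+ n = (v.1 * n%:Z, v.2 * n%:Z).
Proof.
case: v => a b; elim: n => [|n IHn]; first by rewrite !mulr0.
by rewrite mulrS IHn; congr pair => /=; lia.
Qed.

Lemma separates_endpoint (psi : endo) c s (n m : nat) :
    endpoint (s * c ^+ n * (psi s)^-1 * c ^- m)%g = 0 ->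
  endpoint s + endpoint c *+ n = lin psi (endpoint s) + endpoint c *+ m.
Proof.
rewrite !endpointM !endpointV !endpointX endpoint_hom -addrA -opprD.
by move/eqP; rewrite subr_eq0 => /eqP.
Qed.

Lemma separates_flux (psi : endo) c s (n m : nat) h :
    endpoint s = 0 -> endpoint c = 0 ->
    flux h (s * c ^+ n * (psi s)^-1 * c ^- m)%g = 0 ->
  flux h s + flux h c * n%:Z = flux h (psi s) + flux h c * m%:Z.
Proof.
move=> s0 c0; have ps0 : endpoint (psi s) = 0.
  by rewrite endpoint_hom s0 /lin !mulr0 !addr0.
rewrite !fluxM0 ?fluxV0 ?fluxX0 ?endpointM ?endpointV ?endpointX
  ?ps0 ?s0 ?c0 ?mul0rn ?oppr0 ?addr0 //.
by rewrite !pmulrn !mulrzz; lia.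
Qed.

(** * A separating element in each case *)

Section Separation.
Variable psi : endo.
Let p := (endpoint (psi gx)).1.
Let q := (endpoint (psi gy)).1.
Let r := (endpoint (psi gx)).2.
Let t := (endpoint (psi gy)).2.

(** A functional fixed by M agrees on the endpoints of [s] and [psi s], which leaves n - m times its
    nonzero value at [c]. *)
Lemma separating_fixed_vector :
  (p - 1) * (t - 1) - q * r = 0 -> exists c, separates psi c.
Proof.
move=> /left_fixed_vector[l1 [l2 [e1 e2 nz]]].
suff [c lc] : exists c, l1 * (endpoint c).1 + l2 * (endpoint c).2 != 0.
  exists c => s n m /endpoint_lower_central/separates_endpoint.
  rewrite /lin -/p -/q -/r -/t.
  rewrite !plane_mulrn; move: lc; case: (endpoint c) (endpoint s) => c1 c2 [a b].
  move=> /= lc [ea eb].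
  have : (l1 * c1 + l2 * c2) * (n%:Z - m%:Z) = 0.
    have := congr1 ( *%R l1) ea; have := congr1 ( *%R l2) eb.
    have := congr1 ( *%R a) e1; have := congr1 ( *%R b) e2.
    lia.
  by move/eqP; rewrite mulf_eq0 (negPf lc) subr_eq0 => /eqP[].
case/orP: nz => nz; [exists gx; rewrite endpoint_x | exists gy; rewrite endpoint_y].
  by rewrite mulr1 mulr0 addr0.
by rewrite mulr1 mulr0 add0r.
Qed.

Lemma endpoint_eq0 s : (p - 1) * (t - 1) - q * r != 0 ->
  endpoint s = lin psi (endpoint s) -> endpoint s = 0.
Proof.
move=> det0; rewrite /lin -/p -/q -/r -/t; case: (endpoint s) => a b /= [ea eb].
have ha : ((p - 1) * (t - 1) - q * r) * a = 0.
  by have := congr1 ( *%R (t - 1)) ea; have := congr1 ( *%R q) eb; lia.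
have hb : ((p - 1) * (t - 1) - q * r) * b = 0.
  by have := congr1 ( *%R r) ea; have := congr1 ( *%R (p - 1)) eb; lia.
by move/eqP: ha; move/eqP: hb; rewrite !mulf_eq0 (negPf det0) /= => /eqP -> /eqP ->.
Qed.

Lemma separating_commutator : (p - 1) * (t - 1) - q * r != 0 ->
  p * t - q * r = 1 -> separates psi [~ gx, gy]%g.
Proof.
move=> nz det1 s n m Hz.
have cxy := endpointR gx gy.
have s0 : endpoint s = 0.
  apply: endpoint_eq0 => //.
  have := separates_endpoint (endpoint_lower_central Hz).
  by rewrite cxy !mul0rn !addr0.
(* This integrand has constant density 6, so it measures the total winding number, which [psi]
   multiplies by det M = 1. *)
have := separates_flux s0 cxy (flux_lower_central Hz (prim_deg 1 0 0 0 0 0)).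
rewrite flux_xy density_prim /quad /=.
have [l0 [l1 [l2 [l3 [l4 [l5 [k1 [k2 [k3 [k4 [k5 H]]]]]]]]]]] := flux_prim_hom psi s0.
have [-> ->] := H 1 0 0 0 0 0; rewrite -/p -/q -/r -/t det1; lia.
Qed.

Lemma separating_double_commutator : p + t != 0 ->
  p * t - q * r = -1 -> exists c, separates psi c.
Proof.
move=> tr0 detN1.
(* These are the coefficients of Q. If Q were 0, M would be scalar and det M a square; so the polar
   form of Q is nonzero on some pair of generators. *)
have [g [g' nz]] : exists g g', flux (prim 0 0 0 r (t - p) (- q))
    [~ [~ [~ gx, gy], g], g']%g != 0.
  have E := flux_double_commg r (t - p) (- q).
  have [r0|r0] := eqVneq r 0; last first.
    by exists gx, gx; rewrite E endpoint_x /=; apply/eqP; lia.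
  have [q0|q0] := eqVneq q 0; last first.
    by exists gy, gy; rewrite E endpoint_y /=; apply/eqP; lia.
  exists gx, gy; rewrite E endpoint_x endpoint_y /=; apply/eqP => ept.
  by have tp : t = p; [lia | nia].
exists [~ [~ [~ gx, gy], g], g']%g => s n m Hz.
move: nz; set c := [~ _, g']%g => nz.
have c4 : lower_central 4 c by do 3!apply: lower_central_commg.
have c0 : endpoint c = 0 := endpointR _ _.
have s0 : endpoint s = 0.
  (* Here det(M - 1) = - tr M. *)
  apply: endpoint_eq0; first by apply/eqP; lia.
  have := separates_endpoint (endpoint_lower_central Hz).
  by rewrite c0 !mul0rn !addr0.
have flux_s a0 a1 a2 a3 a4 a5 := separates_flux s0 c0
  (flux_lower_central Hz (prim_deg a0 a1 a2 a3 a4 a5)).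
(* Linear densities vanish on the fourth term, so the powers of [c] drop out of the equations of
   degree 0 and 1. *)
have flux_c a0 a1 a2 := flux_lower_central c4 (linear_prim_deg a0 a1 a2).
have [l0 [l1 [l2 [l3 [l4 [l5 [k1 [k2 [k3 [k4 [k5 H]]]]]]]]]]] := flux_prim_hom psi s0.
rewrite -/p -/q -/r -/t detN1 in H.
have l00 : l0 = 0.
  by have := flux_s 1 0 0 0 0 0; rewrite flux_c; have [-> ->] := H 1 0 0 0 0 0; lia.
(* As [l0 = 0], the vector of first moments is killed by M + 1, whose determinant is tr M because
   det M = -1. *)
have E1 : l1 + p * l1 + q * l2 = 0.
  by have := flux_s 0 1 0 0 0 0; rewrite flux_c; have [-> ->] := H 0 1 0 0 0 0; lia.
have E2 : l2 + r * l1 + t * l2 = 0.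
  by have := flux_s 0 0 1 0 0 0; rewrite flux_c; have [-> ->] := H 0 0 1 0 0 0; lia.
have l10 : l1 = 0.
  have : (p + t) * l1 = 0.
    have := congr1 ( *%R (1 + t)) E1; have := congr1 ( *%R q) E2.
    have := congr1 ( *%R l1) detN1; lia.
  by move/eqP; rewrite mulf_eq0 (negPf tr0) => /eqP.
have l20 : l2 = 0.
  have : (p + t) * l2 = 0.
    have := congr1 ( *%R r) E1; have := congr1 ( *%R (1 + p)) E2.
    have := congr1 ( *%R l2) detN1; lia.
  by move/eqP; rewrite mulf_eq0 (negPf tr0) => /eqP.
have := flux_s 0 0 0 r (t - p) (- q); have [-> ->] := H 0 0 0 r (t - p) (- q).
rewrite l00 l10 l20 !mulr0 !addr0 !add0r.
(* The next three identities express - Q(M v) = Q(v), the leading sign being det M; hence [s] and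
   [psi s] have equal flux. *)
have -> : -1 * (r * p ^+ 2 + (t - p) * p * r + - q * r ^+ 2) = r.
  by have := congr1 ( *%R r) detN1; lia.
have -> : -1 * (2 * r * p * q + (t - p) * (p * t + q * r) + 2 * - q * r * t) = t - p.
  by have := congr1 ( *%R (t - p)) detN1; lia.
have -> : -1 * (r * q ^+ 2 + (t - p) * q * t + - q * t ^+ 2) = - q.
  by have := congr1 ( *%R q) detN1; lia.
set f := flux _ c in nz *; move=> ef.
have : f * (n%:Z - m%:Z) = 0 by lia.
by move/eqP; rewrite mulf_eq0 (negPf nz) subr_eq0 => /eqP[].
Qed.

Lemma exists_separating :
  p * t - q * r = 1 \/ p * t - q * r = -1 -> exists c, separates psi c.
Proof.
have [/separating_fixed_vector //|nz] := eqVneq ((p - 1) * (t - 1) - q * r) 0.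
case=> det1; first by exists [~ gx, gy]%g; apply: separating_commutator.
by apply: separating_double_commutator => //; apply: contraNneq nz => tr0; apply/eqP; lia.
Qed.
End Separation.

End Flux.

(** * Lifting automorphisms and counting orbits *)

Section FreeLiftMorphism.
Local Open Scope group_scope.
Variables (r : nat) (H : groupType) (f : 'I_r -> H).

Lemma free_lift_monoid_morphism :
  (free_lift f 1 = 1) * {morph free_lift f : u v / u * v}.
Proof. by split=> // u v; apply: free_liftM. Qed.

HB.instance Definition _ := isUMagmaMorphism.Build (free_group r) H (free_lift f)
  free_lift_monoid_morphism.

End FreeLiftMorphism.

(** Stated for a quotient map so as to cover both F_2 and its nilpotent quotients. By freeness [phi]
    lifts to an endomorphism [psi]. *)
Lemma R_infinity_quotient (G : groupType) (pi : UMagmaMorphism.type F2 G) :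
    (forall a, exists w, pi w = a) ->
    (forall w, pi w = 1%g -> lower_central 5 w) ->
  R_infinity G.
Proof.
move=> pi_surj ker_pi phi [phi' phiK phi'K].
have phi1 : phi 1%g = 1%g by apply: hom1 => u v; rewrite gmulfM.
have [f Hf] := choice (fun i => pi_surj (phi (pi (free_gen i)))).
pose psi : endo := free_lift f.
have piE w : pi (psi w) = phi (pi w).
  have E := @free_lift_unique _ _ (fun i => phi (pi (free_gen i))).
  rewrite (E (fun w => pi (psi w))) ?(E (fun w => phi (pi w))) //.
  - by move=> u v; rewrite !gmulfM.
  - by move=> u v; rewrite !gmulfM.
  - by move=> i; rewrite /psi /= free_lift_gen.
(* M is onto even if [psi] is not: the kernel of [pi] has endpoint 0. *)
have onto v : exists w, lin psi (endpoint w) = endpoint v.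
  have [w Hw] := pi_surj (phi' (pi v)); exists w.
  have : pi (v^-1 * psi w)%g = 1%g by rewrite gmulfM gmulfV piE Hw phi'K mulVg.
  move/ker_pi/endpoint_lower_central; rewrite endpointM endpointV endpoint_hom.
  by rewrite addrC => /eqP; rewrite subr_eq0 => /eqP.
have [c Hc] : exists c, separates psi c.
  apply: exists_separating.
  have [w1] := onto gx; have [w2] := onto gy.
  rewrite endpoint_x endpoint_y /lin.
  case: (endpoint w1) (endpoint w2) => [a b] [a' b'] /=.
  move: (endpoint (psi gx)) (endpoint (psi gy)) => [p r] [q t] /= [e1 e2] [e3 e4].
  (* Preimages of the basis vectors form an integral right inverse of M, so det M is a unit of Z. *)
  have : ((p * t - q * r) * (a * b' - a' * b) = 1)%R.
    transitivity ((p * a' + q * b') * - (r * a + t * b)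
                  + (p * a + q * b) * (r * a' + t * b'))%R; first by ring.
    by rewrite e1 e2 e3 e4.
  move: (p * t - q * r)%R (a * b' - a' * b)%R => D D' DD'.
  have : (D \is a GRing.unit)%R by apply/unitrPr; exists D'.
  by rewrite unfold_in => /orP[] /eqP ->; [left | right].
rewrite /reidemeister_number; case: asboolP => // fin; exfalso.
apply: infinite_nat.
pose orb n := twisted_orbit phi (pi (c ^+ n)%g).
(* Separation makes [orb] injective, so finitely many orbits would make [nat] finite. *)
apply: sub_finite_set (finite_preimage (f := orb) _ fin) => [n _|n m _ _ eq_orb].
  by exists (pi (c ^+ n)%g).
have : orb n (pi (c ^+ m)%g).
  rewrite eq_orb; exists 1%g => //.
  by rewrite phi1 invg1 mulg1 mul1g.
move=> [a _]; have [s <-] := pi_surj a => Hs.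
apply: (Hc s); apply: ker_pi.
by rewrite !gmulfM !gmulfV piE Hs mulgV.
Qed.

(** By normality, [a, b] = a^-1 a^b stays in the term that contains [a]. *)
Lemma lower_centralW (G : groupType) i j :
  (i <= j)%N -> (lower_central j `<=` lower_central (G := G) i)%classic.
Proof.
move=> /subnKC <-; elim: (j - i)%N => [|n IHn]; first by rewrite addn0.
rewrite addnS => w Hw; apply: IHn; case: (i + n)%N Hw => // m.
have [m1 mM mV] := subgroup_lower_central G m.+1.
apply: (smallest_sub (subgroup_lower_central G m.+1)) => _ [a Ha [b _ <-]].
by rewrite commgEl; apply: mM; [apply: mV | apply: lower_central_conj].
Qed.

Theorem theorem3p4 :
  (forall k : nat, 9 <= k -> R_infinity (free_nilpotent 2 k))
  /\ R_infinity (free_group 2).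
Proof.
split=> [k k9|]; last first.
  apply: (@R_infinity_quotient _ idfun) => [a|w w1]; first by exists a.
  have -> : w = 1%g := w1.
  by have [] := subgroup_lower_central F2 5.
apply: (@R_infinity_quotient _ (coset (lower_central_normal F2 k.+1))).
  exact: coset_surj.
move=> w w1; have : coset (lower_central_normal F2 k.+1) 1%g = coset _ w by rewrite w1.
move/cosetP; rewrite invg1 mul1g; apply: lower_centralW.
by rewrite ltnS (leq_trans _ k9).
Qed.
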